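(* Let $\Gamma$ be a finite group, $G$ a group, and $Z\subset G$ a finite subgroup of the center of $G$. Then there are natural identifications of complex vector spaces $$V_Z(\Gamma,G)^{H^2(B\Gamma;Z)^\wedge}\simeq V_{\{e\}}(\Gamma,G),\qquad V_Z(\Gamma,G)^{H^1(B\Gamma;Z)}\simeq V_{\{e\}}(\Gamma,G/Z),$$ where $V^K$ denotes the subspace of $V$ invariant under the group $K$. (Here natural means induced by the identification of $(Z,0)$-twisted homomorphisms with genuine homomorphisms $\Gamma\to G$, respectively by the descent of $(Z,w)$-twisted homomorphisms from $\Gamma$ to $G$ to genuine homomorphisms $\Gamma\to G/Z$.)
   Context: For a finite abelian group $A$, $A^\wedge=\mathrm{Hom}(A,U(1))$ is the Pontryagin dual with pairing $(-,-)$. For each class $w\in H^2(B\Gamma;Z)$ (group cohomology, trivial coefficients) fix a central extension $0\to Z\to\check\Gamma_{Z,w}\xrightarrow{p}\Gamma\to0$ of class $w$. A $(Z,w)$-twisted homomorphism from $\Gamma$ to $G$ is a homomorphism $f:\check\Gamma_{Z,w}\to G$ whose restriction to $Z\subset\check\Gamma_{Z,w}$ is the inclusion $Z\subset G$. Let $\psi_{Z,w}(\Gamma,G)$ be the set of such $f$ modulo conjugation by $G$; for $w=0$ this is the set of homomorphisms $\Gamma\to G$ modulo conjugation. An element $z\in H^1(B\Gamma;Z)=\mathrm{Hom}(\Gamma,Z)$ acts by $[f]\mapsto[zf]$, $(zf)(\bar\gamma)=z(p(\bar\gamma))f(\bar\gamma)$. $V_{Z,w}(\Gamma,G)$ is the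 complex vector space with basis $v([f])$, $[f]\in\psi_{Z,w}(\Gamma,G)$, and $V_Z(\Gamma,G)=\bigoplus_{w\in H^2(B\Gamma;Z)}V_{Z,w}(\Gamma,G)$. On it $z\in H^1(B\Gamma;Z)$ acts by $z\,v([f])=v([zf])$, and $\hat w\in H^2(B\Gamma;Z)^\wedge$ acts on $V_{Z,w}(\Gamma,G)$ by the scalar $(\hat w,w)$. In particular $V_{\{e\}}(\Gamma,G)$ is the complex vector space with basis the conjugacy classes of homomorphisms $\Gamma\to G$. *)

(* Defs.v *)
From HB Require Import structures.
From mathcomp Require Import all_boot all_order all_algebra all_fingroup.
From mathcomp Require Import finmap boolp reals.
From mathcomp Require Import complex freeg.

Set Implicit Arguments.
Unset Strict Implicit.
Unset Printing Implicit Defensive.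

Import GRing.Theory.

Local Open Scope quotient_scope.
Local Open Scope ring_scope.
Local Open Scope group_scope.

(* fingroup's repr shadows the section of a quotient *)
Local Notation qrepr := generic_quotient.repr.

Record finCentralSubgroup (G : groupType) := FinCentralSubgroup {
  fcs_set : {fset G};
  fcs_group : group_closed (mem fcs_set);
  fcs_central : forall z x : G, z \in fcs_set -> z * x = x * z
}.

Section FinCentralSubgroup.
Variables (G : groupType) (Z : finCentralSubgroup G).

Definition fcs_sort : predArgType := fcs_set Z.

HB.instance Definition _ := Finite.on fcs_sort.
HB.instance Definition _ := SubType.on fcs_sort.
HB.instance Definition _ :=
  SubChoice_isSubGroup.Build G _ fcs_sort (fcs_group Z).

End FinCentralSubgroup.

Coercion fcs_sort : finCentralSubgroup >-> predArgType.

Section FinCentralSubgroupTheory.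
Variables (G : groupType) (Z : finCentralSubgroup G).

Lemma fcs_1 : 1 \in fcs_set Z.
Proof. by have [] := fcs_group Z. Qed.

Lemma fcs_V x : x \in fcs_set Z -> x^-1 \in fcs_set Z.
Proof. exact: (group_closedV (fcs_group Z)). Qed.

Lemma fcs_M x y : x \in fcs_set Z -> y \in fcs_set Z -> x * y \in fcs_set Z.
Proof. exact: (group_closedM (fcs_group Z)). Qed.

Lemma fcs_valC (z : Z) (x : G) : val z * x = x * val z.
Proof. exact: fcs_central (valP z). Qed.

Lemma fcs_mulC (z t : Z) : z * t = t * z.
Proof. by apply: val_inj; rewrite !valM fcs_valC. Qed.

Lemma fcs_mulACA (a b c d : Z) : (a * b) * (c * d) = (a * c) * (b * d).
Proof. by rewrite -!mulgA; congr (_ * _); rewrite !mulgA [b * c]fcs_mulC. Qed.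

End FinCentralSubgroupTheory.

Section CentralQuotient.
Variables (G : groupType) (Z : finCentralSubgroup G).

Definition cq_rel (x y : G) : bool := x^-1 * y \in fcs_set Z.

Fact cq_rel_equiv : equiv_class_of cq_rel.
Proof.
split=> [x | x y | y x z]; rewrite /cq_rel ?mulVg ?fcs_1 //.
  by apply/idP/idP => /fcs_V; rewrite invgM invgK.
move=> xy yz; have -> : x^-1 * z = (x^-1 * y) * (y^-1 * z).
  by rewrite !mulgA mulgK.
exact: fcs_M.
Qed.

Canonical cq_equiv := EquivRelPack cq_rel_equiv.
Canonical cq_encModRel := defaultEncModRel cq_rel.

Definition central_quotient := {eq_quot cq_rel}.

HB.instance Definition _ := Choice.on central_quotient.
HB.instance Definition _ := EqQuotient.on central_quotient.

Definition cq_proj : G -> central_quotient := \pi_central_quotient.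

Lemma cq_projP (x y : G) :
  reflect (exists z : Z, y = x * val z) (cq_proj x == cq_proj y).
Proof.
rewrite /cq_proj piE /= /cq_rel; apply: (iffP idP) => [Zxy | [z ->]].
  by exists (Sub (x^-1 * y) Zxy : Z); rewrite SubK mulVKg.
by rewrite mulKg; exact: valP.
Qed.

Lemma cq_projMr (x : G) (z : Z) : cq_proj (x * val z) = cq_proj x.
Proof. by apply/esym/eqP/cq_projP; exists z. Qed.

Lemma cq_repr (x : G) : exists z : Z, qrepr (cq_proj x) = x * val z.
Proof. by apply/cq_projP; rewrite /cq_proj reprK. Qed.

Definition cq_one : central_quotient := cq_proj 1.
Definition cq_mul (a b : central_quotient) : central_quotient :=
  cq_proj (qrepr a * qrepr b).
Definition cq_inv (a : central_quotient) : central_quotient :=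
  cq_proj (qrepr a)^-1.

Lemma cq_projM_subproof (x y : G) :
  cq_mul (cq_proj x) (cq_proj y) = cq_proj (x * y).
Proof.
rewrite /cq_mul; have [z ->] := cq_repr x; have [t ->] := cq_repr y.
by rewrite -mulgA [val z * _]fcs_valC !mulgA cq_projMr cq_projMr.
Qed.

Lemma cq_projV_subproof (x : G) : cq_inv (cq_proj x) = cq_proj x^-1.
Proof.
rewrite /cq_inv; have [z ->] := cq_repr x.
apply/eqP/cq_projP; exists z.
by rewrite -fcs_valC invgM mulgA mulgV mul1g.
Qed.

Lemma cq_ind (P : central_quotient -> Prop) :
  (forall x, P (cq_proj x)) -> forall a, P a.
Proof. by move=> IH a; rewrite -[a]reprK; exact: IH. Qed.

Fact cq_mulA : associative cq_mul.
Proof.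
elim/cq_ind=> x; elim/cq_ind=> y; elim/cq_ind=> z.
by rewrite !cq_projM_subproof mulgA.
Qed.

Fact cq_mul1g : left_id cq_one cq_mul.
Proof. by elim/cq_ind=> x; rewrite cq_projM_subproof mul1g. Qed.

Fact cq_mulg1 : right_id cq_one cq_mul.
Proof. by elim/cq_ind=> x; rewrite cq_projM_subproof mulg1. Qed.

Fact cq_mulVg : left_inverse cq_one cq_inv cq_mul.
Proof.
by elim/cq_ind=> x; rewrite cq_projV_subproof cq_projM_subproof mulVg.
Qed.

Fact cq_mulgV : right_inverse cq_one cq_inv cq_mul.
Proof.
by elim/cq_ind=> x; rewrite cq_projV_subproof cq_projM_subproof mulgV.
Qed.

HB.instance Definition _ := isGroup.Build central_quotient
  cq_mulA cq_mul1g cq_mulg1 cq_mulVg cq_mulgV.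

Fact cq_projM : {morph cq_proj : x y / x * y}.
Proof. by move=> x y; rewrite -cq_projM_subproof. Qed.

HB.instance Definition _ :=
  isMultiplicative.Build G central_quotient cq_proj cq_projM.

End CentralQuotient.

Section SecondCohomology.
Variables (Gam : finGroupType) (G : groupType) (Z : finCentralSubgroup G).

(* Z is written multiplicatively, so the zero class of H2 is 1; cochains are not
   assumed normalized. *)
Definition cochain2 := {ffun Gam * Gam -> Z}.

HB.instance Definition _ := Group.on cochain2.
HB.instance Definition _ := Finite.on cochain2.

Definition cocycle2 : {set cochain2} :=
  [set c : cochain2 | [forall g, forall h, forall k,
    c (g, h) * c (g * h, k) == c (h, k) * c (g, h * k)]].

Definition diff1 (phi : {ffun Gam -> Z}) : cochain2 :=
  [ffun gh => phi gh.1 * phi gh.2 * (phi (gh.1 * gh.2))^-1].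

Definition coboundary2 : {set cochain2} := [set diff1 phi | phi : {ffun Gam -> Z}].

Lemma cochain2ME (c d : cochain2) x : (c * d) x = c x * d x.
Proof. by rewrite ffunE. Qed.

Fact cocycle2_group_set : group_set cocycle2.
Proof.
apply/group_setP; split=> [|c d].
  by rewrite inE; do 3!apply/forallP=> ?; rewrite !ffunE.
rewrite !inE => /forallP Hc /forallP Hd; apply/forallP=> g.
apply/forallP=> h; apply/forallP=> k; rewrite !ffunE.
have /eqP cE := forallP (forallP (Hc g) h) k.
have /eqP dE := forallP (forallP (Hd g) h) k.
apply/eqP; rewrite mulgA -(mulgA (c _)) [d _ * c _]fcs_mulC mulgA cE -mulgA dE.
by rewrite -!mulgA; congr (_ * _); rewrite !mulgA [c _ * d _]fcs_mulC.
Qed.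

Canonical cocycle2_group := Group cocycle2_group_set.

Fact coboundary2_group_set : group_set coboundary2.
Proof.
apply/group_setP; split=> [|c d].
  apply/imsetP; exists [ffun _ => 1] => //.
  by apply/ffunP=> x; rewrite !ffunE mulg1 mulgV.
move=> /imsetP[phi _ ->] /imsetP[psi _ ->]; apply/imsetP.
exists [ffun g => phi g * psi g] => //; apply/ffunP=> -[g h].
rewrite !ffunE /= fcs_mulACA; congr (_ * _); first exact: fcs_mulACA.
by rewrite invgM fcs_mulC.
Qed.

Canonical coboundary2_group := Group coboundary2_group_set.

Definition H2 : finGroupType := subg_of (cocycle2 / coboundary2)%G.

Definition H2_class (c : cochain2) : H2 :=
  subg (cocycle2 / coboundary2)%G (coset coboundary2 c).

End SecondCohomology.

(* ext_of_class: the class of an extension is that of the cocycle c of any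
   set-theoretic section s, with the convention s g * s h = c (g, h) * s (g h). *)
Record centralExtension (Gam : finGroupType) (G : groupType)
    (Z : finCentralSubgroup G) (w : H2 Gam Z) := CentralExtension {
  ext_group :> groupType;
  ext_in : {multiplicative Z -> ext_group};
  ext_pr : {multiplicative ext_group -> Gam};
  ext_in_inj : injective ext_in;
  ext_pr_surj : forall g, exists x, ext_pr x = g;
  ext_exact : forall x, ext_pr x = 1 <-> exists z, x = ext_in z;
  ext_central : forall z x, ext_in z * x = x * ext_in z;
  ext_of_class : exists (s : Gam -> ext_group) (c : cochain2 Gam Z),
    [/\ forall g, ext_pr (s g) = g,
        forall g h, s g * s h = ext_in (c (g, h)) * s (g * h),
        c \in cocycle2 Gam Z
      & w = H2_class c]
}.

Definition conjugate (E G : groupType) (f f' : {multiplicative E -> G}) : Prop :=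
  exists g : G, forall x, f' x = g * f x * g^-1.

Lemma conjugate_equiv (T : Type) (E G : groupType)
    (h : T -> {multiplicative E -> G}) :
  equiv_class_of (fun a b => `[< conjugate (h a) (h b) >]).
Proof.
have sym a b : conjugate (h a) (h b) -> conjugate (h b) (h a).
  case=> g Hg; exists g^-1 => x.
  by rewrite Hg invgK !mulgA mulVg mul1g -mulgA mulVg mulg1.
split=> [a | a b | b a c].
- by apply/asboolP; exists 1 => x; rewrite mul1g invg1 mulg1.
- by apply/asboolP/asboolP; apply: sym.
move=> /asboolP[g Hg] /asboolP[k Hk]; apply/asboolP; exists (k * g) => x.
by rewrite Hk Hg invgM !mulgA.
Qed.

Section HomClass.
Variables E G : groupType.

HB.instance Definition _ := gen_eqMixin {multiplicative E -> G}.
HB.instance Definition _ := gen_choiceMixin {multiplicative E -> G}.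

Definition hom_rel (f f' : {multiplicative E -> G}) : bool :=
  `[< conjugate f f' >].

Canonical hom_equiv := EquivRelPack
  (conjugate_equiv id : equiv_class_of hom_rel).
Canonical hom_encModRel := defaultEncModRel hom_rel.

Definition homClass := {eq_quot hom_rel}.

HB.instance Definition _ := Choice.on homClass.
HB.instance Definition _ := EqQuotient.on homClass.

Definition hom_class : {multiplicative E -> G} -> homClass := \pi_homClass.

Lemma hom_classP f f' : hom_class f = hom_class f' <-> conjugate f f'.
Proof.
split=> [/eqP | ff']; first by rewrite /hom_class piE => /asboolP.
by apply/eqP; rewrite /hom_class piE; apply/asboolP.
Qed.

End HomClass.

Section TwistedHom.
Variables (Gam : finGroupType) (G : groupType) (Z : finCentralSubgroup G).
Variables (w : H2 Gam Z) (E : centralExtension w).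

Record twistedHom := TwistedHom {
  thom :> {multiplicative E -> G};
  thom_in : forall z : Z, thom (ext_in E z) = val z
}.

HB.instance Definition _ := gen_eqMixin twistedHom.
HB.instance Definition _ := gen_choiceMixin twistedHom.

Definition thom_rel (f f' : twistedHom) : bool := `[< conjugate f f' >].

Canonical thom_equiv := EquivRelPack
  (conjugate_equiv thom : equiv_class_of thom_rel).
Canonical thom_encModRel := defaultEncModRel thom_rel.

Definition thomClass := {eq_quot thom_rel}.

HB.instance Definition _ := Choice.on thomClass.
HB.instance Definition _ := EqQuotient.on thomClass.

Definition thom_class : twistedHom -> thomClass := \pi_thomClass.

Lemma thom_classP (f f' : twistedHom) : thom_class f = thom_class f' <-> conjugate f f'.
Proof.
split=> [/eqP | ff']; first by rewrite /thom_class piE => /asboolP.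
by apply/eqP; rewrite /thom_class piE; apply/asboolP.
Qed.

Lemma thom_repr (f : twistedHom) : conjugate f (qrepr (thom_class f)).
Proof. by apply/thom_classP; rewrite /thom_class reprK. Qed.

Section Twist.
Variable z : {multiplicative Gam -> Z}.

Definition twist_fun (f : twistedHom) (x : E) : G := val (z (ext_pr E x)) * f x.

Fact twist_fun_mul f : {morph twist_fun f : x y / x * y}.
Proof.
move=> x y; rewrite /twist_fun [ext_pr E _]gmulfM [z _]gmulfM [f _]gmulfM valM -!mulgA; congr (_ * _).
by rewrite !mulgA fcs_valC.
Qed.

HB.instance Definition _ f :=
  isMultiplicative.Build E G (twist_fun f) (twist_fun_mul f).

Fact twist_fun_in f t : twist_fun f (ext_in E t) = val t.
Proof.
have /ext_exact pt1 : exists t', ext_in E t = ext_in E t' by exists t.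
have z1 : z 1 = 1 by apply: (mulgI (z 1)); rewrite -gmulfM !mulg1.
by rewrite /twist_fun pt1 z1 val1 mul1g thom_in.
Qed.

Definition twist (f : twistedHom) : twistedHom := TwistedHom (twist_fun_in f).

(* Defined through a representative; twist_classE is the independence of the
   choice, and likewise for descend_class and untwist_class below. *)
Definition twist_class (a : thomClass) : thomClass :=
  thom_class (twist (qrepr a)).

Lemma twist_classE f : twist_class (thom_class f) = thom_class (twist f).
Proof.
apply/esym/thom_classP; have [g Hg] := thom_repr f; exists g => x /=.
by rewrite /twist_fun Hg !mulgA fcs_valC.
Qed.

End Twist.

Section Descent.

Definition lift_elt (g : Gam) : E := sval (cid (ext_pr_surj E g)).

Lemma ext_pr_lift g : ext_pr E (lift_elt g) = g.
Proof. exact: svalP (cid (ext_pr_surj E g)). Qed.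

(* independent of the chosen preimage of g, by descend_funE *)
Definition descend_fun (f : twistedHom) (g : Gam) : central_quotient Z :=
  cq_proj Z (f (lift_elt g)).

Lemma descend_funE f (x : E) : descend_fun f (ext_pr E x) = cq_proj Z (f x).
Proof.
rewrite /descend_fun; set y := lift_elt _.
have [z xE] : exists z, y^-1 * x = ext_in E z.
  apply/ext_exact; apply: (mulgI (ext_pr E y)).
  by rewrite -gmulfM mulVKg mulg1 ext_pr_lift.
by rewrite -[x](mulVKg y) xE gmulfM thom_in cq_projMr.
Qed.

Fact descend_fun_mul f : {morph descend_fun f : g h / g * h}.
Proof.
move=> g h; rewrite -[g]ext_pr_lift -[h]ext_pr_lift -gmulfM !descend_funE.
by rewrite !gmulfM.
Qed.

HB.instance Definition _ f := isMultiplicative.Build Gam (central_quotient Z)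
  (descend_fun f) (descend_fun_mul f).

Definition descend (f : twistedHom) : {multiplicative Gam -> central_quotient Z} :=
  descend_fun f.

Definition descend_class (a : thomClass) : homClass Gam (central_quotient Z) :=
  hom_class (descend (qrepr a)).

Lemma descend_classE f : descend_class (thom_class f) = hom_class (descend f).
Proof.
apply/esym/hom_classP; have [g Hg] := thom_repr f.
exists (cq_proj Z g) => x; rewrite -[x]ext_pr_lift /= !descend_funE Hg !gmulfM.
congr (_ * _); apply: (mulgI (cq_proj Z g)).
rewrite -gmulfM !mulgV.
by apply: (mulgI (cq_proj Z 1)); rewrite -gmulfM !mulg1.
Qed.

End Descent.

Section Splitting.

Definition splitting (s : {multiplicative Gam -> E}) : Prop :=
  forall g, ext_pr E (s g) = g.

Variable s : {multiplicative Gam -> E}.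

(* s splits the extension of class 0, whose twisted homomorphisms f are thereby
   identified with the homomorphisms f \o s on Gam. *)
Definition untwist (f : twistedHom) : {multiplicative Gam -> G} := f \o s.

Definition untwist_class (a : thomClass) : homClass Gam G :=
  hom_class (untwist (qrepr a)).

Lemma untwist_classE f : untwist_class (thom_class f) = hom_class (untwist f).
Proof.
apply/esym/hom_classP; have [g Hg] := thom_repr f.
by exists g => x; exact: Hg.
Qed.

End Splitting.

End TwistedHom.

Section Linear.
Local Open Scope ring_scope.

Section FreeExtension.
Variables (R : nzRingType) (K : choiceType) (M : lmodType R) (f : K -> M).

Fact fglift_is_linear : linear (fglift f : {freeg K / R} -> M).
Proof.
have liftB := @lift_is_additive R K M f.
have lift0 : fglift f 0 = 0 by rewrite -[X in fglift f X](subrr 0) liftB subrr.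
have liftN D : fglift f (- D) = - fglift f D by rewrite -[- D]sub0r liftB lift0 sub0r.
have liftD : {morph fglift f : D1 D2 / D1 + D2}.
  by move=> D1 D2; rewrite -[D2 in LHS]opprK liftB liftN opprK.
move=> c D1 D2; rewrite liftD; congr (_ + _).
have liftE : fglift f D1 = \sum_(x <- dom D1) coeff x D1 *: f x.
  rewrite -[D1 in LHS]freeg_sumE (big_morph _ liftD lift0).
  by apply: eq_bigr => x _; rewrite liftU.
have -> : c *: D1 = \sum_(x <- dom D1) << c * coeff x D1 *g x >> by [].
rewrite liftE scaler_sumr (big_morph _ liftD lift0).
by apply: eq_bigr => x _; rewrite liftU scalerA.
Qed.

HB.instance Definition _ :=
  GRing.isLinear.Build R {freeg K / R} M *:%R (fglift f) fglift_is_linear.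

End FreeExtension.

Section DirectSum.
Variables (R : pzRingType) (I : finType) (V : I -> lmodType R).

(* I is finite, so the direct sum is the product *)
Definition dirSum := {dffun forall i : I, V i}.

HB.instance Definition _ := Choice.on dirSum.

Definition ds_zero : dirSum := [ffun i => 0].
Definition ds_opp (u : dirSum) : dirSum := [ffun i => - u i].
Definition ds_add (u v : dirSum) : dirSum := [ffun i => u i + v i].
Definition ds_scale (a : R) (u : dirSum) : dirSum := [ffun i => a *: u i].

Fact ds_addA : associative ds_add.
Proof. by move=> u v x; apply/ffunP=> i; rewrite !ffunE addrA. Qed.

Fact ds_addC : commutative ds_add.
Proof. by move=> u v; apply/ffunP=> i; rewrite !ffunE addrC. Qed.

Fact ds_add0 : left_id ds_zero ds_add.
Proof. by move=> u; apply/ffunP=> i; rewrite !ffunE add0r. Qed.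

Fact ds_addN : left_inverse ds_zero ds_opp ds_add.
Proof. by move=> u; apply/ffunP=> i; rewrite !ffunE addNr. Qed.

HB.instance Definition _ :=
  GRing.isZmodule.Build dirSum ds_addA ds_addC ds_add0 ds_addN.

Fact ds_scaleA a b u : ds_scale a (ds_scale b u) = ds_scale (a * b) u.
Proof. by apply/ffunP=> i; rewrite !ffunE scalerA. Qed.

Fact ds_scale1 : left_id 1 ds_scale.
Proof. by move=> u; apply/ffunP=> i; rewrite !ffunE scale1r. Qed.

Fact ds_scaleDr : right_distributive ds_scale +%R.
Proof. by move=> a u v; apply/ffunP=> i; rewrite !ffunE scalerDr. Qed.

Fact ds_scaleDl u : {morph ds_scale^~ u : a b / a + b}.
Proof. by move=> a b; apply/ffunP=> i; rewrite !ffunE scalerDl. Qed.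

HB.instance Definition _ := GRing.Zmodule_isLmodule.Build R dirSum
  ds_scaleA ds_scale1 ds_scaleDr ds_scaleDl.

Lemma dirSum_scaleDE a (u v : dirSum) i : (a *: u + v) i = a *: u i + v i.
Proof. by rewrite !ffunE. Qed.

End DirectSum.

Section DirectSumMap.
Variables (R : pzRingType) (I : finType) (V W : I -> lmodType R).
Variable h : forall i, {linear V i -> W i}.

Definition dirSum_map (u : dirSum V) : dirSum W := [ffun i => h i (u i)].

Fact dirSum_map_is_linear : linear dirSum_map.
Proof. by move=> a u v; apply/ffunP=> i; rewrite !ffunE linearP. Qed.

HB.instance Definition _ := GRing.isLinear.Build R (dirSum V) (dirSum W) *:%R
  dirSum_map dirSum_map_is_linear.

End DirectSumMap.

Section FixedPoints.
Variables (R : pzRingType) (K : Type) (V : lmodType R).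
Variable act : K -> {linear V -> V}.

Definition fixed_pred : {pred V} := fun v => `[< forall k, act k v = v >].

Fact fixed_submod_closed : submod_closed fixed_pred.
Proof.
split=> [|a u v /asboolP Hu /asboolP Hv]; apply/asboolP=> k.
  by rewrite linear0.
by rewrite linearP Hu Hv.
Qed.

HB.instance Definition _ := GRing.isSubmodClosed.Build R V fixed_pred
  fixed_submod_closed.

Record fixedPoints : predArgType := FixedPoints {
  fixed_val :> V;
  fixed_valP : fixed_val \in fixed_pred
}.

HB.instance Definition _ := [isSub for fixed_val].
HB.instance Definition _ := [Choice of fixedPoints by <:].
HB.instance Definition _ := [SubChoice_isSubLmodule of fixedPoints by <:].

End FixedPoints.

End Linear.

Definition Cplx (R : realType) : numClosedFieldType := R[i]%C.

(* U(1) is the set of complex numbers of modulus 1 *)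
Record pontryaginDual (R : realType) (A : groupType) := PontryaginDual {
  pd_fun :> A -> Cplx R;
  pd_norm : forall a, `|pd_fun a|%R = 1%R;
  pd_mul : forall a b, pd_fun (a * b) = (pd_fun a * pd_fun b)%R
}.

Section Spaces.
Local Open Scope ring_scope.

Variable R : realType.

Definition basis_vec (K : choiceType) (k : K) : {freeg K / (Cplx R)} :=
  [freeg [:: (1, k)]].

Section FreeMap.
Variables (K L : choiceType) (f : K -> L).

Definition free_map : {freeg K / (Cplx R)} -> {freeg L / (Cplx R)} :=
  fglift (fun k => basis_vec (f k)).

HB.instance Definition _ := GRing.Linear.on free_map.

Lemma free_map_basis k : free_map (basis_vec k) = basis_vec (f k).
Proof. by rewrite /free_map /basis_vec liftU scale1r. Qed.

End FreeMap.

Definition homSpace (Gam G : groupType) : lmodType (Cplx R) :=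
  {freeg (homClass Gam G) / (Cplx R)}.

Section Twisted.
Variables (Gam : finGroupType) (G : groupType) (Z : finCentralSubgroup G).
Variable E : forall w : H2 Gam Z, centralExtension w.

Definition twistedSpace (w : H2 Gam Z) : lmodType (Cplx R) :=
  {freeg (thomClass (E w)) / (Cplx R)}.

Definition totalSpace : lmodType (Cplx R) := dirSum twistedSpace.

Definition H1 := {multiplicative Gam -> Z}.

Definition H1_act (z : H1) : {linear totalSpace -> totalSpace} :=
  dirSum_map (fun w => free_map (twist_class (E := E w) z)).

(* chi acts on the summand of index w as the scalar chi w *)
Definition H2dual_act (chi : pontryaginDual R (H2 Gam Z)) :
    {linear totalSpace -> totalSpace} :=
  dirSum_map (fun w => chi w \*: @idfun (twistedSpace w)).

Definition untwist_map (s : {multiplicative Gam -> E 1%g}) (v : totalSpace) :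
    homSpace Gam G :=
  free_map (untwist_class s) ((v : dirSum twistedSpace) 1%g).

Definition descend_map (v : totalSpace) : homSpace Gam (central_quotient Z) :=
  \sum_(w : H2 Gam Z)
    free_map (descend_class (E := E w)) ((v : dirSum twistedSpace) w).

End Twisted.

End Spaces.

Arguments homSpace : clear implicits.
Arguments H1_act R {Gam G Z} E z.
Arguments H2dual_act R {Gam G Z} E chi.
Arguments untwist_map R {Gam G Z} E s v.
Arguments descend_map R {Gam G Z} E v.

(* Main.v *)
(* First isomorphism: characters separate the points of the finite abelian group
   H2, so an invariant vector lives in the summand w = 1, where the extension
   splits and twisted homomorphisms are homomorphisms.

   Second isomorphism: the obstruction to lifting a homomorphism Gam -> G/Z to G
   is a 2-cocycle, which the twist absorbs, so every such homomorphism comes from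
   a twisted one for exactly one w. The classes of twisted homomorphisms above a
   given class form a single H1-orbit, so its average over H1 is, up to scale,
   the unique invariant vector above that class. *)

Require Import Defs.
From HB Require Import structures.
From mathcomp Require Import all_boot all_order all_algebra all_fingroup.
From mathcomp Require Import cyclic separable cyclotomic algC classfun character.
From mathcomp Require Import finmap boolp reals.
From mathcomp Require Import complex freeg.

Set Implicit Arguments.
Unset Strict Implicit.
Unset Printing Implicit Defensive.

Import GRing.Theory Num.Theory.

Local Open Scope group_scope.

(** * Group homomorphisms and the central quotient *)

Lemma multiplicative1 (G H : groupType) (f : {multiplicative G -> H}) : f 1 = 1.
Proof. by apply: (mulgI (f 1)); rewrite -gmulfM !mulg1. Qed.

Lemma multiplicativeV (G H : groupType) (f : {multiplicative G -> H}) :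
  {morph f : x / x^-1}.
Proof.
by move=> x; apply: (mulgI (f x)); rewrite -gmulfM !mulgV multiplicative1.
Qed.

Lemma eq_cq_proj (G : groupType) (Z : finCentralSubgroup G) (x y : G) :
  cq_proj Z x = cq_proj Z y -> exists z : Z, y = val z * x.
Proof.
by move=> /eqP/cq_projP[z ->]; exists z; rewrite fcs_valC.
Qed.

(** * Equality of classes in degree-two cohomology *)

Section Cohomology.
Variables (Gam : finGroupType) (G : groupType) (Z : finCentralSubgroup G).
Implicit Types c d : cochain2 Gam Z.

Lemma cochain2_abelian (A : {set cochain2 Gam Z}) : abelian A.
Proof.
apply/centsP=> c _ d _; apply/ffunP=> x.
by rewrite !cochain2ME fcs_mulC.
Qed.

Lemma cochain2_norm_coboundary c : c \in 'N(coboundary2 Gam Z).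
Proof.
apply: (subsetP (cent_sub _)); apply/centP=> d _; apply/ffunP=> x.
by rewrite !cochain2ME fcs_mulC.
Qed.

Lemma H2_class_eq c (phi : Gam -> Z) d :
  (forall g h, c (g, h) = phi g * phi h * (phi (g * h))^-1 * d (g, h)) ->
  H2_class c = H2_class d.
Proof.
move=> cE; have -> : c = diff1 [ffun g => phi g] * d.
  by apply/ffunP=> -[g h]; rewrite cE cochain2ME !ffunE.
congr (subg _ _); apply: coset_kerl; exact: imset_f.
Qed.

(** Equal cosets put [c * d^-1] in [coboundary2], whose elements are by definition some
    [diff1 phi]. *)
Lemma H2_class_inj c d : c \in cocycle2 Gam Z -> d \in cocycle2 Gam Z ->
  H2_class c = H2_class d ->
  exists phi : Gam -> Z,
    forall g h, c (g, h) = phi g * phi h * (phi (g * h))^-1 * d (g, h).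
Proof.
move=> Zc Zd /(congr1 val); rewrite /= !subgK ?mem_quotient // => /eqP.
move=> /eqP cd.
have : coset (coboundary2 Gam Z) (c * d^-1) = 1.
  rewrite morphM ?morphV ?cochain2_norm_coboundary //= cd mulgV //.
move=> /coset_idr -/(_ (cochain2_norm_coboundary _)) /imsetP[phi _ E].
exists phi => g h; have := congr1 (fun e : cochain2 Gam Z => (e * d) (g, h)) E.
by rewrite mulgVK => ->; rewrite cochain2ME !ffunE.
Qed.

Lemma H2_class1 : H2_class (1 : cochain2 Gam Z) = 1.
Proof. by apply: val_inj; rewrite /= subgK ?mem_quotient ?group1 // coset_id. Qed.

(** This makes the irreducible characters of [H2] linear, which is how they become elements of the
    Pontryagin dual. *)
Lemma H2_abelian : abelian [set: H2 Gam Z].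
Proof.
apply/centsP=> x _ y _; apply: val_inj.
have /centsP cA : abelian (cocycle2 Gam Z / coboundary2 Gam Z).
  exact/quotient_abelian/cochain2_abelian.
exact: cA (valP x) _ (valP y).
Qed.

End Cohomology.

(** * Set-theoretic sections of an extension and the twisted homomorphisms they define *)

Section Extension.
Variables (Gam : finGroupType) (G : groupType) (Z : finCentralSubgroup G).
Variables (w : H2 Gam Z) (E : centralExtension w).

(** The extension comes with a section for one cocycle of the class [w]. Multiplying that section by
    [phi] changes the cocycle by the coboundary of [phi], so every cocycle of the class is
    reached. *)
Lemma ext_section (c : cochain2 Gam Z) : c \in cocycle2 Gam Z ->
  w = H2_class c -> exists s : Gam -> E,
    (forall g, ext_pr E (s g) = g) /\
    (forall g h, s g * s h = ext_in E (c (g, h)) * s (g * h)).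
Proof.
move=> Zc wc; have [s [d [prs sM Zd wd]]] := ext_of_class E.
have [|phi cE] := H2_class_inj Zc Zd; first by rewrite -wc.
exists (fun g => ext_in E (phi g) * s g); split=> [g | g h].
  have pin : ext_pr E (ext_in E (phi g)) = 1 by apply/ext_exact; exists (phi g).
  by rewrite gmulfM pin mul1g.
rewrite cE !mulgA -[_ * s g * _]mulgA -(ext_central _ (s g)) !mulgA -mulgA sM.
rewrite !mulgA -!gmulfM; congr (ext_in E _ * _).
rewrite -!mulgA; congr (_ * (_ * _)).
by rewrite [d _ * phi _]fcs_mulC mulKg.
Qed.

Lemma ext_decomp (s : Gam -> E) : (forall g, ext_pr E (s g) = g) ->
  forall x, exists z, x = ext_in E z * s (ext_pr E x).
Proof.
move=> prs x; have /ext_exact[z zE] : ext_pr E (x * (s (ext_pr E x))^-1) = 1.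
  by rewrite gmulfM multiplicativeV prs mulgV.
by exists z; rewrite -zE mulgVK.
Qed.

(** Each element of [E] is uniquely [ext_in E z * s g], so the only candidate sends it to
    [val z * l g]. It is multiplicative because [l] and [s] multiply with the same cocycle [c]. *)
Lemma twistedHom_of_section (s : Gam -> E) (c : cochain2 Gam Z) (l : Gam -> G) :
  (forall g, ext_pr E (s g) = g) ->
  (forall g h, s g * s h = ext_in E (c (g, h)) * s (g * h)) ->
  (forall g h, l g * l h = val (c (g, h)) * l (g * h)) ->
  exists f : twistedHom E, forall g, f (s g) = l g.
Proof.
move=> prs sM lM; pose zc x := sval (cid (ext_decomp prs x)).
have zcE x : x = ext_in E (zc x) * s (ext_pr E x).
  exact: svalP (cid (ext_decomp prs x)).
have zc_uniq x z g : x = ext_in E z * s g -> zc x = z /\ ext_pr E x = g.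
  move=> xE; have pin : ext_pr E (ext_in E z) = 1 by apply/ext_exact; exists z.
  have prx : ext_pr E x = g by rewrite xE gmulfM pin mul1g.
  split=> //; apply: (@ext_in_inj _ _ _ _ E); apply: (mulIg (s g)).
  by rewrite -xE -prx -zcE.
pose F x := val (zc x) * l (ext_pr E x).
have FE z g : F (ext_in E z * s g) = val z * l g.
  by rewrite /F; have [-> ->] := zc_uniq (ext_in E z * s g) z g erefl.
have FM : {morph F : x y / x * y}.
  move=> x y; rewrite {1}[x]zcE {1}[y]zcE.
  rewrite -mulgA [s _ * _]mulgA -(ext_central _ (s _)) -[ext_in E (zc y) * _ * _]mulgA sM.
  rewrite !mulgA -!(@gmulfM _ _ (ext_in E)) FE !valM -!mulgA -lM /F.
  by congr (_ * _); rewrite !mulgA fcs_valC.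
pose fM := isMultiplicative.Build E G F FM.
pose f : {multiplicative E -> G} := HB.pack F fM.
(* The cocycle is not normalized, so [s 1] and [l 1] are both the central element [c (1, 1)].
   Dividing by it recovers the prescribed values on [Z]. *)
have s1 : s 1 = ext_in E (c (1, 1)).
  by apply: (mulIg (s 1)); rewrite sM mulg1.
have l1 : l 1 = val (c (1, 1)).
  by apply: (mulIg (l 1)); rewrite lM mulg1.
have f_in z : f (ext_in E z) = val z.
  have -> : ext_in E z = ext_in E (z * (c (1, 1))^-1) * s 1.
    by rewrite s1 -gmulfM mulgVK.
  by rewrite /f/= FE l1 -valM mulgVK.
exists (TwistedHom f_in) => g /=.
by rewrite -[s g]mul1g -[X in X * _](multiplicative1 (ext_in E)) FE val1 mul1g.
Qed.

End Extension.

(** * Twisted homomorphisms for the trivial class *)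

Section TwistedClass.
Variables (Gam : finGroupType) (G : groupType) (Z : finCentralSubgroup G).
Variables (w : H2 Gam Z) (E : centralExtension w).

Lemma thom_classW (P : thomClass E -> Prop) :
  (forall f, P (thom_class f)) -> forall a, P a.
Proof. by move=> IH a; rewrite -[a]reprK; exact: IH. Qed.

Lemma eq_thom_class (f f' : twistedHom E) : f =1 f' -> thom_class f = thom_class f'.
Proof.
by move=> ff'; apply/thom_classP; exists 1 => x; rewrite mul1g invg1 mulg1 ff'.
Qed.

(** The image of [s] together with [Z] generates [E], and the values on [Z] are prescribed and
    central. A conjugation between the restrictions along [s] is thus already one between the
    twisted homomorphisms. *)
Lemma untwist_class_inj (s : {multiplicative Gam -> E}) :
  splitting s -> injective (untwist_class s).
Proof.
move=> prs; elim/thom_classW=> f; elim/thom_classW=> f'.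
rewrite !untwist_classE => /hom_classP[g ff']; apply/thom_classP; exists g => x.
have [z ->] := ext_decomp prs x; have /= := ff' (ext_pr E x).
by rewrite !gmulfM !thom_in => ->; rewrite !mulgA fcs_valC.
Qed.

End TwistedClass.

Lemma hom_classW (E G : groupType) (P : homClass E G -> Prop) :
  (forall f, P (hom_class f)) -> forall a, P a.
Proof. by move=> IH a; rewrite -[a]reprK; exact: IH. Qed.

(** A splitting is a section with trivial cocycle, and a homomorphism [l] satisfies the same
    relation, so [twistedHom_of_section] extends it. *)
Lemma untwist_class_surj (Gam : finGroupType) (G : groupType)
    (Z : finCentralSubgroup G) (E : centralExtension (1 : H2 Gam Z))
    (s : {multiplicative Gam -> E}) (b : homClass Gam G) :
  splitting s -> exists a, untwist_class s a = b.
Proof.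
move=> prs; elim/hom_classW: b => l.
have [g h|g h|f fs] := @twistedHom_of_section _ _ _ _ E s 1 l prs.
- by rewrite -gmulfM ffunE multiplicative1 mul1g.
- by rewrite -gmulfM ffunE val1 mul1g.
exists (thom_class f); rewrite untwist_classE; apply/hom_classP.
by exists 1 => g; rewrite mul1g invg1 mulg1 /= fs.
Qed.

Lemma trivial_class_splits (Gam : finGroupType) (G : groupType)
    (Z : finCentralSubgroup G) (E : centralExtension (1 : H2 Gam Z)) :
  exists s : {multiplicative Gam -> E}, splitting s.
Proof.
have [|s [prs sM]] := ext_section E (group1 (cocycle2_group Gam Z)).
  by rewrite H2_class1.
have sM' : {morph s : g h / g * h}.
  by move=> g h; rewrite sM ffunE multiplicative1 mul1g.
pose m := isMultiplicative.Build Gam E s sM'.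
by exists (HB.pack s m : {multiplicative Gam -> E}).
Qed.

(** * Image and fibers of the descent to [G/Z] *)

Section Descent.
Variables (Gam : finGroupType) (G : groupType) (Z : finCentralSubgroup G).

(** The two extensions may differ: [descend_class_index] compares distinct ones,
    [descend_class_fiber] uses a single one. *)
Lemma descend_conj (w w' : H2 Gam Z) (E : centralExtension w)
    (E' : centralExtension w') (f : twistedHom E) (f' : twistedHom E') :
  Defs.conjugate (descend f) (descend f') ->
  exists g : G, forall x y, ext_pr E x = ext_pr E' y ->
    exists z : Z, f' y = val z * (g * f x * g^-1).
Proof.
case=> gbar; elim/cq_ind: gbar => g ff'; exists g => x y xy.
apply: eq_cq_proj; have := ff' (ext_pr E x).
rewrite {1}xy [descend f' _]descend_funE [descend f _]descend_funE => ->.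
by rewrite !(@gmulfM _ _ (cq_proj Z)) -(@multiplicativeV _ _ (cq_proj Z)).
Qed.

(** Along sections [s] and [s'], the values of [f'] and of a conjugate of [f] differ by a function
    [zt] into [Z]. The coboundary of [zt] is the quotient of the two cocycles. *)
Lemma descend_class_index (w w' : H2 Gam Z) (E : centralExtension w)
    (E' : centralExtension w') (a : thomClass E) (a' : thomClass E') :
  descend_class a = descend_class a' -> w = w'.
Proof.
elim/thom_classW: a => f; elim/thom_classW: a' => f'.
rewrite !descend_classE => /hom_classP/descend_conj[g ff'].
have [s [c [prs sM Zc wc]]] := ext_of_class E.
have [s' [c' [prs' sM' Zc' wc']]] := ext_of_class E'.
have {}ff' h : exists z : Z, f' (s' h) = val z * (g * f (s h) * g^-1).
  by apply: ff'; rewrite prs prs'.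
pose zt h := sval (cid (ff' h)).
have ztE h : f' (s' h) = val (zt h) * (g * f (s h) * g^-1).
  exact: svalP (cid (ff' h)).
rewrite wc wc'; apply/esym; apply: (H2_class_eq (phi := zt)) => h k.
apply: val_inj; apply: (mulIg (f' (s' (h * k)))).
rewrite !valM -(thom_in f') -gmulfM -sM' gmulfM !ztE.
have fM : f (s h) * f (s k) = val (c (h, k)) * f (s (h * k)).
  by rewrite -gmulfM sM gmulfM thom_in.
(* Central factors move to the front and the inner [g^-1 * g] cancels. *)
have -> : val (zt h) * (g * f (s h) * g^-1) * (val (zt k) * (g * f (s k) * g^-1)) =
    val (zt h) * val (zt k) * (g * (f (s h) * f (s k)) * g^-1).
  rewrite -!mulgA; congr (_ * _).
  by rewrite [RHS]fcs_valC [val (zt k) * _]fcs_valC -!mulgA mulKg.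
rewrite fM !mulgA -[_ * g * val _]mulgA -(fcs_valC (c (h, k)) g) !mulgA.
congr (_ * _ * _ * _); rewrite -!valM; congr (val _).
by rewrite -!mulgA [c _ * _]fcs_mulC mulKg.
Qed.

(** Representatives [l g] of [phi g] multiply up to a factor [c] in [Z]. The class of [c] is the
    required index [w], and [l] defines a twisted homomorphism there. *)
Lemma descend_class_surj (E : forall w : H2 Gam Z, centralExtension w)
    (b : homClass Gam (central_quotient Z)) :
  exists w, exists a : thomClass (E w), descend_class a = b.
Proof.
elim/hom_classW: b => phi; pose l g : G := generic_quotient.repr (phi g).
have lE g : cq_proj Z (l g) = phi g by exact: reprK.
have lM g h : exists z : Z, l g * l h = val z * l (g * h).
  apply: eq_cq_proj; rewrite lE [phi _]gmulfM -[phi g]lE -[phi h]lE.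
  exact/esym/(@gmulfM _ _ (cq_proj Z)).
pose c : cochain2 Gam Z := [ffun gh => sval (cid (lM gh.1 gh.2))].
have cE g h : l g * l h = val (c (g, h)) * l (g * h).
  by rewrite ffunE; exact: svalP (cid (lM g h)).
have Zc : c \in cocycle2 Gam Z.
  rewrite inE; apply/forallP=> g; apply/forallP=> h; apply/forallP=> k.
  (* The cocycle identity is the associativity of [l g * l h * l k], read off after multiplying by
     [l (g * h * k)]. *)
  apply/eqP/val_inj/(mulIg (l (g * h * k))).
  transitivity (l g * l h * l k); first by rewrite valM -mulgA -cE mulgA -cE.
  by apply/esym; rewrite valM -mulgA -[g * h * k]mulgA -cE mulgA fcs_valC -!mulgA -cE.
have [s [prs sM]] := ext_section (E (H2_class c)) Zc erefl.
have [f fs] := twistedHom_of_section prs sM cE.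
exists (H2_class c), (thom_class f); rewrite descend_classE.
apply/hom_classP; exists 1 => g.
by rewrite mul1g invg1 mulg1 -{2}[g]prs [descend f _]descend_funE fs lE.
Qed.

Lemma descend_class_twist (w : H2 Gam Z) (E : centralExtension w)
    (z : {multiplicative Gam -> Z}) (a : thomClass E) :
  descend_class (twist_class z a) = descend_class a.
Proof.
elim/thom_classW: a => f; rewrite twist_classE !descend_classE.
apply/hom_classP; exists 1 => g; rewrite mul1g invg1 mulg1 -[g](ext_pr_lift E).
rewrite [descend f _]descend_funE [descend _ _]descend_funE /= /twist_fun.
by rewrite fcs_valC cq_projMr.
Qed.

(** The ratio of [f'] to a conjugate of [f] takes values in [Z]. It factors through [Gam] since both
    agree on [Z], and it is multiplicative since it is a central ratio of two homomorphisms. *)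
Lemma descend_class_fiber (w : H2 Gam Z) (E : centralExtension w)
    (a a' : thomClass E) :
  descend_class a = descend_class a' ->
  exists z : {multiplicative Gam -> Z}, a' = twist_class z a.
Proof.
elim/thom_classW: a => f; elim/thom_classW: a' => f'.
rewrite !descend_classE => /hom_classP/descend_conj[g ff'].
pose zt h := sval (cid (ff' (lift_elt E h) _ erefl)).
(* The relation holds by choice of [zt] at the lifts [lift_elt E h]; it spreads to every [x] because
   [f'] and [f] scale alike under [Z]. *)
have ztE x : f' x = val (zt (ext_pr E x)) * (g * f x * g^-1).
  have f'l : f' (lift_elt E (ext_pr E x)) =
      val (zt (ext_pr E x)) * (g * f (lift_elt E (ext_pr E x)) * g^-1).
    exact: svalP (cid (ff' (lift_elt E (ext_pr E x)) _ erefl)).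
  have [z {1 3}->] := ext_decomp (ext_pr_lift E) x.
  rewrite !gmulfM !thom_in f'l !mulgA fcs_valC -!mulgA; congr (_ * _).
  by rewrite mulgA fcs_valC -mulgA.
have ztM : {morph zt : h k / h * k}.
  move=> h k; rewrite -[h](ext_pr_lift E) -[k](ext_pr_lift E).
  set x := lift_elt E h; set y := lift_elt E k.
  rewrite -gmulfM; apply: val_inj; apply: (mulIg (g * f (x * y) * g^-1)).
  rewrite -ztE valM !gmulfM !ztE -!mulgA; congr (_ * _).
  by rewrite [RHS]fcs_valC [val (zt _) * _]fcs_valC -!mulgA mulKg.
pose m := isMultiplicative.Build Gam Z zt ztM.
exists (HB.pack zt m : {multiplicative Gam -> Z}).
rewrite twist_classE; apply/thom_classP; exists g^-1 => x /=.
rewrite /twist_fun /= ztE invgK mulgA -fcs_valC -!mulgA; congr (_ * _).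
by rewrite mulKg mulVg mulg1.
Qed.

End Descent.

(** The product [v] enters through its values, so that it can be any homomorphism with these values,
    such as one from [finHom_mul]. *)
Lemma twist_classM (Gam : finGroupType) (G : groupType)
    (Z : finCentralSubgroup G) (w : H2 Gam Z) (E : centralExtension w)
    (z u v : {multiplicative Gam -> Z}) (a : thomClass E) :
  (forall g, v g = z g * u g) ->
  twist_class z (twist_class u a) = twist_class v a.
Proof.
move=> vE; elim/thom_classW: a => f; rewrite !twist_classE.
apply: eq_thom_class => x.
by rewrite /= /twist_fun vE [LHS]mulgA; congr (_ * _); exact/esym/valM.
Qed.

(** * Characters separate the points of a finite abelian group *)

Section Characters.
Local Open Scope ring_scope.

(** In characteristic zero ['X^n - 1] is separable and splits, so it has [n] distinct roots, one of
    which is primitive. *)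
Lemma closed_prim_root_exists (F : numClosedFieldType) n :
  (0 < n)%N -> exists z : F, n.-primitive_root z.
Proof.
pose p : {poly F} := 'X^n - 1; have [r Dp] := closed_field_poly_normal p.
move=> n_gt0; rewrite (monicP _) ?monicXnsubC // scale1r in Dp.
have rn1: all n.-unity_root r by apply/allP=> z; rewrite -root_prod_XsubC -Dp.
have sz_r: (n < (size r).+1)%N.
  by rewrite -(size_prod_XsubC r id) -Dp size_XnsubC.
have [|z] := hasP (has_prim_root n_gt0 rn1 _ sz_r); last by exists z.
by rewrite -separable_prod_XsubC -Dp separable_Xn_sub_1 // pnatr_eq0 -lt0n.
Qed.

Lemma pontryaginDual_separates (R : realType) (A : finGroupType) (a : A) :
  abelian [set: A] -> a != 1%g ->
  exists chi : pontryaginDual R A, chi a != 1.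
Proof.
move=> abA a1; pose n := #|A|; have n_gt0 : (0 < n)%N.
  by apply/card_gt0P; exists a.
(* The kernels of the irreducible characters meet trivially, so [a != 1] escapes one of them. *)
have [i chi_a] : exists i : Iirr [set: A], 'chi_i a != 1.
  apply/existsP; rewrite -negb_forall; apply: contra a1 => /forallP chi1.
  rewrite -in_set1 -[[set 1%g]](TI_cfker_irr [set: A]%G).
  apply/bigcapP=> i _; rewrite cfkerEirr inE (eqP (chi1 i)) eq_sym.
  by have /andP[_ ->] := char_abelianP _ abA i.
have lin := char_abelianP _ abA i.
(* The values of ['chi_i] are powers of [z] in [algC]; replacing [z] by a primitive root [t] of the
   same order carries the character over to [Cplx R]. *)
have [z prz] := closed_prim_root_exists algC n_gt0.
have [t prt] := closed_prim_root_exists (Cplx R) n_gt0.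
have chi_root x : 'chi_i x ^+ n = 1.
  by rewrite -lin_charX ?inE // /n -cardsT expg_cardG ?inE // lin_char1.
pose k x : nat := sval (prim_rootP prz (chi_root x)).
have kE x : 'chi_i x = z ^+ k x := svalP (prim_rootP prz (chi_root x)).
have t_norm : `|t| = 1.
  by apply/eqP; rewrite -(pexpr_eq1 n_gt0) // -normrX (prim_expr_order prt) normr1.
have chi_norm x : `|t ^+ k x| = 1 by rewrite normrX t_norm expr1n.
(* The exponents [k] add up only modulo [n], which is exactly what powers of [t] detect. *)
have chiM x y : t ^+ k (x * y)%g = t ^+ k x * t ^+ k y.
  apply/eqP; rewrite -exprD (eq_prim_root_expr prt) -(eq_prim_root_expr prz).
  by rewrite exprD -!kE lin_charM ?inE.
exists (PontryaginDual chi_norm chiM) => /=.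
apply: contra chi_a => /eqP; rewrite kE -{1}(expr0 t) => /eqP.
by rewrite (eq_prim_root_expr prt) -(eq_prim_root_expr prz) expr0.
Qed.

End Characters.

(** * Linear maps on free spaces and invariants under the dual of [H2] *)

Section Linear.
Local Open Scope ring_scope.
Variable R : realType.

Lemma freeg_linear_ind (K : choiceType) (P : {freeg K / Cplx R} -> Prop) :
  P 0 -> (forall c u v, P u -> P v -> P (c *: u + v)) ->
  (forall k, P (basis_vec R k)) -> forall u, P u.
Proof.
move=> P0 PD Pk u; rewrite -(freeg_sumE u).
elim/big_rec: _ => // k v _ Pv.
suff -> : << coeff k u *g k >> = coeff k u *: basis_vec R k by exact: PD.
by apply/eqP/freeg_eqP=> x; rewrite coeffZ !coeffU mul1r.
Qed.

Lemma free_map_can (K L : choiceType) (f : K -> L) (g : L -> K) :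
  cancel f g -> cancel (free_map (R := R) f) (free_map g).
Proof.
move=> fK; elim/freeg_linear_ind => [|c u v fgu fgv|k].
- by rewrite !linear0.
- by rewrite !linearP /= fgu fgv.
- by rewrite !free_map_basis fK.
Qed.

Section Twisted.
Variables (Gam : finGroupType) (G : groupType) (Z : finCentralSubgroup G).
Variable E : forall w : H2 Gam Z, centralExtension w.

Lemma act_fixed_val (K : Type) (act : K -> {linear totalSpace R E -> totalSpace R E})
  (v : fixedPoints act) k : act k (fixed_val v) = fixed_val v.
Proof. by have /asboolP := fixed_valP v. Qed.

(** Invariance says that [chi w - 1] kills the component at [w] for all [chi]; for [w != 1] a
    separating character makes this scalar nonzero. *)
Lemma H2dual_fixedP (v : totalSpace R E) :
  v \in fixed_pred (H2dual_act R E) <->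
  (forall w, w != 1%g -> (v : dirSum (twistedSpace R E)) w = 0).
Proof.
split=> [/asboolP fix_v w /(pontryaginDual_separates R (H2_abelian _ _)) [chi chiw] | v0].
  have /(congr1 (fun u : dirSum (twistedSpace R E) => u w)) := fix_v chi.
  rewrite ffunE /= => /eqP; rewrite -subr_eq0 -[X in _ - X]scale1r -scalerBl.
  by rewrite scaler_eq0 subr_eq0 (negPf chiw) => /eqP.
apply/asboolP=> chi; apply/ffunP=> w; rewrite ffunE /=.
have [->|/v0->] := eqVneq w 1%g; last exact: scaler0.
have chi1 : chi 1%g = 1.
  have chi0 : chi 1%g != 0 by rewrite -normr_eq0 pd_norm oner_eq0.
  by apply: (mulfI chi0); rewrite -pd_mul mulg1 mulr1.
by rewrite chi1 scale1r.
Qed.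

Lemma untwist_map_linear (s : {multiplicative Gam -> E 1%g}) : linear (untwist_map R E s).
Proof. by move=> a u v; rewrite /untwist_map dirSum_scaleDE linearP. Qed.

Lemma descend_map_linear : linear (descend_map R E).
Proof.
move=> a u v; rewrite /descend_map scaler_sumr -big_split /=.
by apply: eq_bigr => w _; rewrite dirSum_scaleDE linearP.
Qed.

End Twisted.
End Linear.

(** * Finite summation over [H1] *)

Section FiniteHom.
Variables (Gam : finGroupType) (G : groupType) (Z : finCentralSubgroup G).

(* a finite copy of H1, over which one can sum *)
Definition finHom : finType :=
  {f : {ffun Gam -> Z} | [forall g, forall h, f (g * h) == f g * f h]}.

Lemma finHomM (f : finHom) : {morph (val f : {ffun Gam -> Z}) : g h / g * h}.
Proof. by move=> g h; apply/eqP; have /forallP/(_ g)/forallP/(_ h) := valP f. Qed.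

Definition hom_of_finHom (f : finHom) : {multiplicative Gam -> Z} :=
  HB.pack (val f : Gam -> Z) (isMultiplicative.Build Gam Z _ (finHomM f)).

Lemma finHom_of_hom (z : {multiplicative Gam -> Z}) :
  exists f : finHom, hom_of_finHom f =1 z.
Proof.
pose zf : {ffun Gam -> Z} := [ffun g => z g].
have zP : [forall g, forall h, zf (g * h) == zf g * zf h].
  by apply/forallP=> g; apply/forallP=> h; rewrite !ffunE gmulfM.
by exists (Sub zf zP) => g; rewrite /= ffunE.
Qed.

(** Translation by [z], as a bijection along which sums over [finHom] are reindexed. *)
Lemma finHom_mul (z : {multiplicative Gam -> Z}) :
  exists2 m : finHom -> finHom, bijective m &
    forall f g, hom_of_finHom (m f) g = z g * hom_of_finHom f g.
Proof.
have mM (f : finHom) : {morph (fun g => z g * hom_of_finHom f g) : g h / g * h}.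
  by move=> g h; rewrite !gmulfM fcs_mulACA.
have mP f : exists f' : finHom, forall g, hom_of_finHom f' g = z g * hom_of_finHom f g.
  pose h : {multiplicative Gam -> Z} := HB.pack (fun g => z g * hom_of_finHom f g)
    (isMultiplicative.Build Gam Z _ (mM f)).
  exact: (finHom_of_hom h).
pose m f := sval (cid (mP f)).
have mE f g : hom_of_finHom (m f) g = z g * hom_of_finHom f g.
  exact: svalP (cid (mP f)) g.
exists m => //; apply: injF_bij => f f' ff'; apply/val_inj/ffunP => g.
by have := mE f g; rewrite ff' mE => /mulgI.
Qed.

End FiniteHom.

(** * Averaging over [H1] and invariant lifts of classes *)

Section Average.
Local Open Scope ring_scope.
Variables (R : realType) (Gam : finGroupType) (G : groupType).
Variables (Z : finCentralSubgroup G).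

Lemma card_finHom_neq0 : #|finHom Gam Z|%:R != 0 :> Cplx R.
Proof.
have [f _] := finHom_of_hom (@one_fun Gam Z : {multiplicative Gam -> Z}).
by rewrite pnatr_eq0 -lt0n; apply/card_gt0P; exists f.
Qed.

Lemma average_const (V : lmodType (Cplx R)) (v : V) :
  #|finHom Gam Z|%:R^-1 *: (\sum_(f : finHom Gam Z) v) = v.
Proof.
rewrite sumr_const -[v *+ _]scaler_nat scalerA mulVf ?card_finHom_neq0 //.
exact: scale1r.
Qed.

Section OneClass.
Variables (w : H2 Gam Z) (E : centralExtension w).
Implicit Types (a : thomClass E) (u : {freeg (thomClass E) / Cplx R}).

(** The projector onto the [H1]-invariants of one summand. *)
Definition average u := #|finHom Gam Z|%:R^-1 *:
  \sum_(f : finHom Gam Z) free_map (twist_class (hom_of_finHom f)) u.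

Lemma average_linear : linear average.
Proof.
move=> c u v; rewrite /average scalerA mulrC -scalerA -scalerDr; congr (_ *: _).
by rewrite scaler_sumr -big_split /=; apply: eq_bigr => f _; rewrite linearP.
Qed.

HB.instance Definition _ := GRing.isLinear.Build (Cplx R)
  {freeg (thomClass E) / Cplx R} {freeg (thomClass E) / Cplx R} *:%R
  average average_linear.

Lemma average_fixed u :
  (forall z : {multiplicative Gam -> Z}, free_map (twist_class z) u = u) ->
  average u = u.
Proof.
move=> fix_u; rewrite /average (eq_bigr (fun=> u)) => [|f _]; last exact: fix_u.
exact: average_const.
Qed.

Lemma free_map_twist_average (z : {multiplicative Gam -> Z}) u :
  free_map (twist_class z) (average u) = average u.
Proof.
have [m m_bij mE] := finHom_mul z.
elim/freeg_linear_ind: u => [|c u v IHu IHv|a].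
- by rewrite !linear0.
- by rewrite !linearP /= IHu IHv.
rewrite linearZ linear_sum /= /average; congr (_ *: _).
rewrite [RHS](reindex m) /=; last exact: onW_bij.
by apply: eq_bigr => f _; rewrite !free_map_basis (twist_classM _ (mE f)).
Qed.

(** Here the translation acts on the other side than in [free_map_twist_average]; commutativity of
    [Z] makes the reindexing the same. *)
Lemma average_twist (z : {multiplicative Gam -> Z}) u :
  average (free_map (twist_class z) u) = average u.
Proof.
have [m m_bij mE] := finHom_mul z.
elim/freeg_linear_ind: u => [|c u v IHu IHv|a].
- by rewrite !linear0.
- by rewrite !linearP /= IHu IHv.
rewrite /average; congr (_ *: _).
rewrite [RHS](reindex m) /=; last exact: onW_bij.
apply: eq_bigr => f _; rewrite !free_map_basis.
rewrite (@twist_classM _ _ _ _ _ _ _ (hom_of_finHom (m f))) // => g.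
by rewrite mE fcs_mulC.
Qed.

Lemma descend_average u :
  free_map (descend_class (E := E)) (average u) = free_map (descend_class (E := E)) u.
Proof.
elim/freeg_linear_ind: u => [|c u v IHu IHv|a].
- by rewrite !linear0.
- by rewrite !linearP /= IHu IHv.
rewrite linearZ linear_sum /= (eq_bigr (fun=> basis_vec R (descend_class a))).
  by rewrite average_const free_map_basis.
by move=> f _; rewrite !free_map_basis descend_class_twist.
Qed.

(** The invariant vector above [b] in the summand of [w], or 0 if [b] does not come from this
    summand. By [lift_class_descend] it does not depend on the chosen preimage. *)
Definition lift_class (b : homClass Gam (central_quotient Z)) :
    {freeg (thomClass E) / Cplx R} :=
  if pselect (exists a : thomClass E, descend_class a = b) is left ab
  then average (basis_vec R (sval (cid ab))) else 0.

Lemma lift_class_fixed (z : {multiplicative Gam -> Z}) b :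
  free_map (twist_class z) (lift_class b) = lift_class b.
Proof.
rewrite /lift_class; case: pselect => [ab|_]; last exact: linear0.
exact: free_map_twist_average.
Qed.

Lemma lift_class_descend a : lift_class (descend_class a) = average (basis_vec R a).
Proof.
rewrite /lift_class; case: pselect => [ab|[]]; last by exists a.
(* The chosen preimage [a'] is replaced by a twist of [a] or conversely, and the average does not
   see the twist. *)
case: (cid ab) => a' /= /descend_class_fiber[z ->].
by rewrite -(free_map_basis R (twist_class z)) average_twist.
Qed.

End OneClass.

Lemma lift_class_other (w w' : H2 Gam Z) (E : centralExtension w)
    (E' : centralExtension w') (a : thomClass E) :
  w != w' -> lift_class E' (descend_class a) = 0.
Proof.
move=> ww'; rewrite /lift_class; case: pselect => // -[a' aa'].
by rewrite (descend_class_index aa') eqxx in ww'.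
Qed.

End Average.

(** * The two isomorphisms *)

Section Isomorphisms.
Local Open Scope ring_scope.
Variables (R : realType) (Gam : finGroupType) (G : groupType).
Variables (Z : finCentralSubgroup G).
Variable E : forall w : H2 Gam Z, centralExtension w.

Local Notation V := (totalSpace R E).

Lemma untwist_iso (s : {multiplicative Gam -> E 1%g}) : splitting s ->
  exists Phi : {linear fixedPoints (H2dual_act R E) -> homSpace R Gam G},
    bijective Phi /\ forall v, Phi v = untwist_map R E s (fixed_val v).
Proof.
move=> prs.
pose Phi0 (v : fixedPoints (H2dual_act R E)) := untwist_map R E s (fixed_val v).
have Phi_lin : linear Phi0 by move=> a u v; rewrite -untwist_map_linear.
pose Phi : {linear fixedPoints (H2dual_act R E) -> homSpace R Gam G} :=
  HB.pack Phi0 (GRing.isLinear.Build _ _ _ _ Phi0 Phi_lin).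
exists Phi; split=> //.
pose g b : thomClass (E 1%g) := sval (cid (untwist_class_surj b prs)).
have gK : cancel g (untwist_class s).
  by move=> b; exact: svalP (cid (untwist_class_surj b prs)).
have Kg : cancel (untwist_class s) g by apply: inj_can_sym gK (untwist_class_inj prs).
(* The inverse extends by zero outside [w = 1]. The summand type depends on [w], hence the transport
   along [1 = w], which [eq_axiomK] removes at [w = 1]. *)
pose supp1 (u : homSpace R Gam G) : V := [ffun w =>
  match 1%g =P w return twistedSpace R E w with
  | ReflectT e => eq_rect _ (twistedSpace R E) (free_map g u) _ e
  | ReflectF _ => 0
  end].
have supp11 u : (supp1 u : dirSum (twistedSpace R E)) 1%g = free_map g u.
  by rewrite ffunE; case: eqP => // e; rewrite (eq_axiomK e).
have supp1P u : supp1 u \in fixed_pred (H2dual_act R E).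
  apply/H2dual_fixedP => w w1; rewrite ffunE; case: eqP => // e.
  by rewrite -e eqxx in w1.
exists (fun u => FixedPoints (supp1P u)) => [v|u].
  apply/val_inj/ffunP => w /=.
  have [->|w1] := eqVneq w 1%g; first by rewrite supp11 free_map_can.
  have /H2dual_fixedP v0 := fixed_valP v; have /H2dual_fixedP u0 := supp1P (Phi v).
  by rewrite v0 ?u0.
by rewrite /= /Phi0 /untwist_map /= supp11 free_map_can.
Qed.

Lemma descend_iso :
  exists Psi :
     {linear fixedPoints (H1_act R E) -> homSpace R Gam (central_quotient Z)},
     bijective Psi /\ forall v, Psi v = descend_map R E (fixed_val v).
Proof.
pose Psi0 (v : fixedPoints (H1_act R E)) := descend_map R E (fixed_val v).
have Psi_lin : linear Psi0 by move=> a u v; rewrite -descend_map_linear.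
pose Psi : {linear fixedPoints (H1_act R E) -> homSpace R Gam (central_quotient Z)} :=
  HB.pack Psi0 (GRing.isLinear.Build _ _ _ _ Psi0 Psi_lin).
exists Psi; split=> //.
(* The inverse: each basis class goes to its invariant lift in every summand, which vanishes in all
   but one. *)
pose T (b : homSpace R Gam (central_quotient Z)) : V :=
  [ffun w => fglift (lift_class R (E w)) b].
have T_fixed b : T b \in fixed_pred (H1_act R E).
  apply/asboolP=> z; apply/ffunP=> w; rewrite !ffunE.
  elim/freeg_linear_ind: b => [|c u v IHu IHv|b].
  - by rewrite !linear0.
  - by rewrite !linearP /= IHu IHv.
  - by rewrite /basis_vec liftU linearZ /= lift_class_fixed.
have lift_basis w b : fglift (lift_class R (E w)) (basis_vec R b) = lift_class R (E w) b.
  by rewrite /basis_vec liftU scale1r.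
have lift_descend w u :
    fglift (lift_class R (E w)) (free_map (descend_class (E := E w)) u) = average u.
  elim/freeg_linear_ind: u => [|c u v IHu IHv|a].
  - by rewrite !linear0.
  - by rewrite !linearP /= IHu IHv.
  - by rewrite free_map_basis lift_basis lift_class_descend.
have lift_other w w' u : w' != w ->
    fglift (lift_class R (E w)) (free_map (descend_class (E := E w')) u) = 0.
  move=> ww'; elim/freeg_linear_ind: u => [|c u v IHu IHv|a].
  - by rewrite !linear0.
  - by rewrite !linearP /= IHu IHv scaler0 addr0.
  - by rewrite free_map_basis lift_basis lift_class_other.
exists (fun b => FixedPoints (T_fixed b)) => [v|b].
  apply/val_inj/ffunP => w /=.
  (* In the component at [w] only the term of index [w] survives; it is the average of an invariant
     vector, hence that vector. *)
  rewrite ffunE /Psi0 /descend_map linear_sum (bigD1 w) //= big1 ?addr0; last first.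
    by move=> w' ww'; exact: lift_other.
  rewrite lift_descend average_fixed // => z.
  have /(congr1 (fun u : dirSum (twistedSpace R E) => u w)) := act_fixed_val v z.
  by rewrite ffunE.
rewrite /= /Psi0 /descend_map /=.
elim/freeg_linear_ind: b => [|c u v IHu IHv|b].
- by rewrite big1 // => w _; rewrite ffunE !linear0.
- rewrite -[in RHS]IHu -[in RHS]IHv scaler_sumr -big_split /=.
  by apply: eq_bigr => w _; rewrite !ffunE !linearP.
(* A basis class descends from some [a] at an index [w], and the other summands contribute 0. *)
have [w [a <-]] := descend_class_surj E b.
rewrite (bigD1 w) //= big1 ?addr0 => [|w' ww']; rewrite ffunE lift_basis.
  by rewrite lift_class_descend descend_average free_map_basis.
by rewrite lift_class_other 1?eq_sym // linear0.
Qed.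

End Isomorphisms.

Theorem proposition1p14 (R : realType) (Gam : finGroupType) (G : groupType)
    (Z : finCentralSubgroup G)
    (E : forall w : H2 Gam Z, centralExtension w) :
  ((exists s : {multiplicative Gam -> E 1%g}, splitting s) /\
   (forall s : {multiplicative Gam -> E 1%g}, splitting s ->
     exists Phi : {linear fixedPoints (H2dual_act R E) -> homSpace R Gam G},
       bijective Phi /\ forall v, Phi v = untwist_map R E s (fixed_val v))) /\
  (exists Psi :
     {linear fixedPoints (H1_act R E) -> homSpace R Gam (central_quotient Z)},
     bijective Psi /\ forall v, Psi v = descend_map R E (fixed_val v)).
Proof.
split; first split.
- exact: trivial_class_splits.
- by move=> s; exact: untwist_iso.
- exact: descend_iso.
Qed.
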